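(* Every rigidity circuit $C$ has a resultant tree. That is, for every rigidity circuit $C$ with $n$ vertices there is a rooted binary tree $T_C$ with root $C$ such that: (a) every node of $T_C$ is a rigidity circuit; (b) every circuit at level $l$ of $T_C$ (the root being at level $0$) has at most $n-l$ vertices; (c) every internal node $C_i$ has exactly two children $C_j, C_k$, and there is a common edge $e\in E(C_j)\cap E(C_k)$ with $C_i=\mathrm{CR}(C_j,C_k,e)$; (d) every leaf is a complete graph $K_4$. In particular every rigidity circuit can be obtained from copies of $K_4$ by repeated combinatorial resultant operations.
   Context: All graphs are finite and simple; a graph is given by a set of edges, and its vertex set is the set of endpoints of its edges. A graph $G=(V,E)$ is $(2,3)$-sparse if every subset $V'\subseteq V$ with $|V'|\ge 2$ spans at most $2|V'|-3$ edges. A Laman graph is a $(2,3)$-sparse graph with $|E|=2|V|-3$. A rigidity circuit (also called sparsity circuit) is a graph $C=(V,E)$ with $|E|=2|V|-2$ such that every proper subset $V'\subsetneq V$ with $|V'|\ge 2$ spans at most $2|V'|-3$ edges; equivalently, a minimal edge set which is not $(2,3)$-sparse (a circuit of the $(2,3)$-sparsity matroid on the edges of $K_n$). Combinatorial resultant: for two distinct graphs $G_1=(V_1,E_1)$, $G_2=(V_2,E_2)$ and a common edge $e\in E_1\cap E_2$, $\mathrm{CR}(G_1,G_2,e)$ is the graph with vertex set $V_1\cup V_2$ and edge set $(E_1\cup E_2)\setminus\{e\}$. *)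

(* Defs.v *)
From mathcomp Require Import all_boot.
Set Implicit Arguments. Unset Strict Implicit. Unset Printing Implicit Defensive.

(* Graphs: vertices drawn from a finite universe T; a graph is a set of
   edges, each edge a 2-element set of vertices (simple graph). *)
Section Graphs.
Variable T : finType.
Definition graph := {set {set T}}.

Definition is_graph (G : graph) : Prop := forall e, e \in G -> #|e| = 2.

Definition vset (G : graph) : {set T} := \bigcup_(e in G) e.

Definition span (G : graph) (V' : {set T}) : graph := [set e in G | e \subset V'].

Definition sparse23 (G : graph) : Prop :=
  forall V' : {set T}, V' \subset vset G -> 2 <= #|V'| -> #|span G V'| + 3 <= 2 * #|V'|.

Definition is_circuit (G : graph) : Prop :=
  [/\ is_graph G,
      #|G| + 2 = 2 * #|vset G| &
      forall V' : {set T}, V' \proper vset G -> 2 <= #|V'| ->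
        #|span G V'| + 3 <= 2 * #|V'|].

Definition is_K4 (G : graph) : Prop :=
  #|vset G| = 4 /\ G = [set e : {set T} | (e \subset vset G) && (#|e| == 2)].

Definition is_CR (G G1 G2 : graph) (e : {set T}) : Prop :=
  [/\ G1 != G2, e \in G1 :&: G2,
      vset G = vset G1 :|: vset G2 &
      G = (G1 :|: G2) :\ e].

Inductive rtree := Leaf of graph | Node of graph & rtree & rtree.

Definition rt_root (t : rtree) : graph :=
  match t with Leaf G => G | Node G _ _ => G end.

(* res_tree n l t : t is a resultant tree whose root sits at level l of the
   full tree, for a root circuit with n vertices. *)
Fixpoint res_tree (n l : nat) (t : rtree) : Prop :=
  match t with
  | Leaf G => [/\ is_circuit G, #|vset G| + l <= n & is_K4 G]
  | Node G tj tk =>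
      [/\ is_circuit G, #|vset G| + l <= n,
          (exists e, is_CR G (rt_root tj) (rt_root tk) e),
          res_tree n l.+1 tj & res_tree n l.+1 tk]
  end.
End Graphs.

(* Main.v *)
Require Import Defs.
From mathcomp Require Import all_boot.
From mathcomp Require Import zify.

(** A circuit [C] on [n >= 5] vertices has minimum degree 3 and average degree
    below 4, so it has at least four vertices of degree 3; they are not pairwise
    adjacent, since [C] contains no large clique.  Take [a], [b] non-adjacent of
    degree 3.  Then [V - a] and [V - b] are tight (they span [2|X| - 3] edges),
    while [V - a - b] spans one edge less than a tight set, so some pair
    [e = {u, v}] lies in no tight set avoiding both [a] and [b].  Let [X] be a
    minimal tight set containing [e] and avoiding [a], and [Y] one avoiding [b].
    The graphs spanned by [X] and [Y], augmented with [e], are circuits on fewer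
    vertices.  As the intersection of [X] and [Y] is not tight, counting edges
    shows that their resultant on [e] is the whole of [C]. *)

Set Implicit Arguments. Unset Strict Implicit. Unset Printing Implicit Defensive.

(* Cardinals of edge sets are elaborated with or without [reverse_coercion],
   which [lia] would take for distinct atoms. *)
Ltac card_lia := cbv beta delta [reverse_coercion]; lia.

Section Circuits.
Variable T : finType.
Implicit Types (G C : {set {set T}}) (e X Y W : {set T}) (u v : T).

(** * Spanned edges and tight sets *)

Definition tight G X := #|span G X| + 3 == 2 * #|X|.

Definition star G v : {set {set T}} := [set e in G | v \in e].

Lemma span_sub G X : span G X \subset G.
Proof. by apply/subsetP => e; rewrite inE => /andP[]. Qed.

Lemma spanS G X Y : X \subset Y -> span G X \subset span G Y.
Proof.
move=> sXY; apply/subsetP => e; rewrite !inE => /andP[-> /= sX].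
exact: subset_trans sX sXY.
Qed.

Lemma spanI G X Y : span G (X :&: Y) = span G X :&: span G Y.
Proof. by apply/setP => e; rewrite !inE subsetI; case: (e \in G). Qed.

Lemma sub_vset G e : e \in G -> e \subset vset G.
Proof. by move=> eG; apply: bigcup_sup eG. Qed.

Lemma span_vset G : span G (vset G) = G.
Proof.
apply/setP => e; rewrite inE; case eG: (e \in G) => //=.
exact: sub_vset.
Qed.

(** An edge spanned by either set lies in the union; one spanned by both lies in the
    intersection. *)
Lemma span_supermodular G X Y :
  #|span G X| + #|span G Y| <= #|span G (X :|: Y)| + #|span G (X :&: Y)|.
Proof.
have := cardsUI (span G X) (span G Y); rewrite -spanI => <-.
by rewrite leq_add2r subset_leq_card // subUset !spanS ?subsetUl ?subsetUr.
Qed.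

Lemma span_card_le1 G X : is_graph G -> #|X| <= 1 -> span G X = set0.
Proof.
move=> gG X1; apply/setP => e; rewrite !inE; apply/negP => /andP[eG].
by move/subset_leq_card; rewrite gG //; lia.
Qed.

Lemma tight_card_gt1 G X : tight G X -> 2 <= #|X|.
Proof. by rewrite /tight => /eqP; lia. Qed.

Lemma tight_edge G u v : is_graph G -> u != v ->
  [set u; v] \in G -> tight G [set u; v].
Proof.
move=> gG uv eG; have c2 := cards2 u v; rewrite uv in c2.
suff: span G [set u; v] = [set [set u; v]].
  by rewrite /tight => ->; rewrite cards1 c2.
apply/setP => e; rewrite !inE; apply/andP/eqP => [[eG' sub]|-> //].
by apply/eqP; rewrite eqEcard sub c2 gG.
Qed.

(** * Counting pairs and degrees *)

Lemma card_pairs X : #|[set e : {set T} | (e \subset X) && (#|e| == 2)]| = 'C(#|X|, 2).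
Proof. exact: cards_draws. Qed.

Lemma span_card_star G X v : #|span G (X :\ v)| + #|star (span G X) v| = #|span G X|.
Proof.
rewrite -(cardsID [set e : {set T} | v \in e] (span G X)) addnC; congr (_ + _).
  by apply: eq_card => e; rewrite !inE.
by apply: eq_card => e; rewrite !inE subsetD1; case: (v \in e); rewrite ?andbF ?andbT.
Qed.

(** Double counting of vertex-edge incidences. *)
Lemma sum_card_star G : is_graph G -> \sum_(v in vset G) #|star G v| = 2 * #|G|.
Proof.
move=> gG.
under eq_bigr => v _.
  rewrite -sum1_card (eq_bigl (fun e => (e \in G) && (v \in e))); last first.
    by move=> e; rewrite inE.
  over.
rewrite (exchange_big_dep (fun e => e \in G)) /=; last by move=> v e _ /andP[].
rewrite -[#|G|]sum1_card big_distrr /=; apply: eq_bigr => e eG.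
rewrite sum1_card -(gG e eG) muln1; apply: eq_card => v.
rewrite unfold_in eG /=; case ve: (v \in e); rewrite ?andbF ?andbT //.
exact: (subsetP (sub_vset eG)).
Qed.

(** * Uncrossing tight sets *)

(** Localised because a circuit violates the bound on its whole vertex set, but on no proper
    subset. *)
Definition sparse_within G W :=
  forall X, X \subset W -> 2 <= #|X| -> #|span G X| + 3 <= 2 * #|X|.

(** Supermodularity and sparsity of the intersection force at least [2|X :|: Y| - 3] edges on the
    union; sparsity gives the converse. *)
Lemma tightU G W X Y : sparse_within G W -> X \subset W -> Y \subset W ->
  2 <= #|X :&: Y| -> tight G X -> tight G Y -> tight G (X :|: Y).
Proof.
move=> sp sX sY c2 /eqP tX /eqP tY; apply/eqP.
have := span_supermodular G X Y; have := cardsUI X Y.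
have := sp _ (subset_trans (subsetIl X Y) sX) c2.
have := sp (X :|: Y); rewrite subUset sX sY; move/(_ isT).
have := subset_leq_card (subset_trans (subsetIl X Y) (subsetUl X Y)).
lia.
Qed.

(** The spanned edge sets are disjoint and total [2(|X| + |Y| + |Z|) - 9]. The overlaps make the
    union smaller than [|X| + |Y| + |Z|] by at least 3, so it spans at least twice its size minus
    3. *)
Lemma tightU3 G W X Y Z : is_graph G -> sparse_within G W ->
  X :|: Y :|: Z \subset W -> 0 < #|X :&: Y| <= 1 -> #|X :&: Z| <= 1 ->
  #|Y :&: Z| <= 1 -> 2 <= #|(X :|: Y) :&: Z| ->
  tight G X -> tight G Y -> tight G Z -> tight G (X :|: Y :|: Z).
Proof.
move=> gG sp sU /andP[cXY mXY] mXZ mYZ c2 /eqP tX /eqP tY /eqP tZ; apply/eqP.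
have sXY0 : span G X :&: span G Y = set0 by rewrite -spanI span_card_le1.
have sZ0 : (span G X :|: span G Y) :&: span G Z = set0.
  by rewrite setIUl -!spanI !span_card_le1 ?setU0.
have sXYZ : span G X :|: span G Y :|: span G Z \subset span G (X :|: Y :|: Z).
  rewrite !subUset !spanS // ?subsetUr //.
    by apply: subset_trans (subsetUl _ _); apply: subsetUr.
  by apply: subset_trans (subsetUl _ _); apply: subsetUl.
have c := subset_leq_card (subsetIl (X :|: Y) Z).
have c' := subset_leq_card (subsetUl (X :|: Y) Z).
have := sp _ sU (leq_trans c2 (leq_trans c c')).
have := subset_leq_card sXYZ.
have := cardsUI (span G X) (span G Y); rewrite sXY0 cards0.
have := cardsUI (span G X :|: span G Y) (span G Z); rewrite sZ0 cards0.
have := cardsUI X Y; have := cardsUI (X :|: Y) Z.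
clear -tX tY tZ c2 cXY; lia.
Qed.

(* If every pair lay in a tight set, a maximal tight set [X] missing [w] could
   be enlarged: choose tight [Y] through [w, x] and [Z] through [w, y] with
   [x, y] in [X]; either two of the three sets share two vertices, or they
   pairwise share exactly one vertex and their union is tight. *)
Lemma exists_untight_pair G W : is_graph G -> sparse_within G W ->
  2 <= #|W| -> ~~ tight G W ->
  exists u v, [/\ u \in W, v \in W, u != v &
    forall X, X \subset W -> u \in X -> v \in X -> ~~ tight G X].
Proof.
move=> gG sp W2 nW.
case: (boolP [exists u in W, exists v in W, (u != v) &&
  [forall X : {set T}, [&& X \subset W, u \in X & v \in X] ==> ~~ tight G X]]).
  case/exists_inP=> u uW /exists_inP[v vW /andP[uv /forallP h]].
  exists u, v; split=> // X sX uX vX; have := h X; by rewrite sX uX vX.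
move=> nex; exfalso.
have cov u v : u \in W -> v \in W -> u != v ->
    exists2 X, tight G X & [&& X \subset W, u \in X & v \in X].
  move=> uW vW uv; move: nex; rewrite negb_exists_in => /forall_inP/(_ u uW).
  rewrite negb_exists_in => /forall_inP/(_ v vW); rewrite uv /= negb_forall.
  by case/existsP=> X; rewrite negb_imply negbK => /andP[h t]; exists X.
have /card_gt1P[p [q [pW qW pq]]] := W2.
have [X0 tX0 /and3P[sX0 _ _]] := cov p q pW qW pq.
have P0 : tight G X0 && (X0 \subset W) by rewrite tX0.
case: (@arg_maxnP _ X0 (fun X => tight G X && (X \subset W)) (fun X => #|X|) P0).
move=> X /andP[tX sX] maxX.
have maxU Y : Y \subset W -> tight G (X :|: Y) -> Y \subset X.
  move=> sY t; have := maxX (X :|: Y); rewrite t subUset sX sY => /(_ isT) le.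
  have : X == X :|: Y by rewrite eqEcard subsetUl.
  by move/eqP=> ->; rewrite subsetUr.
have meet1 Y w : Y \subset W -> tight G Y -> w \in Y -> w \notin X ->
    #|X :&: Y| <= 1.
  move=> sY tY wY wX; rewrite leqNgt; apply/negP => c.
  have /subsetP/(_ w wY) := maxU Y sY (tightU sp sX sY c tX tY).
  by rewrite (negbTE wX).
have [w wW wX] : exists2 w, w \in W & w \notin X.
  apply/subsetPn; apply/negP => sWX; move: nW.
  have -> : W = X by apply/eqP; rewrite eqEsubset sWX.
  by rewrite tX.
have /card_gt1P[x [y [xX yX xy]]] := tight_card_gt1 tX.
have neq z : z \in X -> w != z by move=> zX; apply: contraNneq wX => ->.
have [Y tY /and3P[sY wY xY]] := cov w x wW (subsetP sX x xX) (neq x xX).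
have [Z tZ /and3P[sZ wZ yZ]] := cov w y wW (subsetP sX y yX) (neq y yX).
have mY := meet1 Y w sY tY wY wX; have mZ := meet1 Z w sZ tZ wZ wX.
(* Otherwise [Y :|: Z] would be a tight set through [w] sharing both [x] and [y] with [X]. *)
have mYZ : #|Y :&: Z| <= 1.
  rewrite leqNgt; apply/negP => c.
  have sYZ : Y :|: Z \subset W by rewrite subUset sY.
  have := meet1 _ w sYZ (tightU sp sY sZ c tY tZ); rewrite inE wY => /(_ isT wX).
  rewrite leqNgt => /negP; apply; apply/card_gt1P; exists x, y.
  by rewrite !inE xX yX xY yZ orbT.
have c2 : 2 <= #|(X :|: Y) :&: Z|.
  by apply/card_gt1P; exists w, y; rewrite !inE wY wZ yX yZ orbT neq.
have sU : X :|: Y :|: Z \subset W by rewrite !subUset sX sY.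
suff tU : tight G (X :|: Y :|: Z).
  have /subsetP/(_ w) : Y :|: Z \subset X.
    by apply: maxU; rewrite ?setUA // subUset sY.
  by rewrite inE wY (negbTE wX) => /(_ isT).
have cXY : 0 < #|X :&: Y| by apply/card_gt0P; exists x; rewrite inE xX.
by apply: (tightU3 gG sp) => //; rewrite cXY.
Qed.

(** * Edge counts and degrees in a circuit *)

Lemma bin2_lower_bound n : 3 * n <= 'C(n, 2) + 6.
Proof.
(* The difference of the two sides is [(n - 3)(n - 4)/2]; induction starts at 3. *)
case: n => [|[|[|n]]] //; elim: n => // n IH.
by rewrite binS bin1; lia.
Qed.

Section Circuit.
Variable C : {set {set T}}.
Hypothesis circC : is_circuit C.
Let V := vset C.

Lemma circuit_graph : is_graph C.
Proof. by case: circC. Qed.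

Lemma circuit_card : #|C| + 2 = 2 * #|V|.
Proof. by case: circC. Qed.

Lemma circuit_sparse X : X \proper V -> 2 <= #|X| -> #|span C X| + 3 <= 2 * #|X|.
Proof. by case: circC => _ _; apply. Qed.

Lemma circuit_sub_pairs : C \subset [set e : {set T} | (e \subset V) && (#|e| == 2)].
Proof.
by apply/subsetP => e eC; rewrite inE sub_vset //= circuit_graph.
Qed.

(** Two or three vertices offer fewer than [2n - 2] pairs; for one vertex the count leaves no edge,
    hence no vertex. *)
Lemma circuit_card_ge4 : 4 <= #|V|.
Proof.
have := subset_leq_card circuit_sub_pairs; rewrite card_pairs bin2.
have V1 : #|V| != 1.
  apply/eqP => V1; have C0 : C = set0.
    by apply/eqP; rewrite -cards_eq0; have := circuit_card; lia.
  by move: V1; rewrite /V C0 /vset big_set0 cards0.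
have := circuit_card; move: #|V| #|C| V1 => [|[|[|[|n]]]] m //=; lia.
Qed.

Lemma circuit_K4 : #|V| = 4 -> is_K4 C.
Proof.
move=> V4; split=> //; apply/eqP; rewrite eqEcard circuit_sub_pairs /=.
by rewrite card_pairs -/V V4; have := circuit_card; rewrite V4 bin2 /=; lia.
Qed.

Lemma circuit_star_card v : #|span C (V :\ v)| + #|star C v| = #|C|.
Proof. by have := span_card_star C V v; rewrite span_vset. Qed.

(** [V :\ v] spans at most [2n - 5] of the [2n - 2] edges. *)
Lemma circuit_min_degree v : v \in V -> 3 <= #|star C v|.
Proof.
move=> vV; have := circuit_star_card v.
have := circuit_sparse (properD1 vV); have := circuit_card; have := circuit_card_ge4.
by have := cardsD1 v V; rewrite vV; lia.
Qed.

Lemma circuit_degree3 v : v \in V -> #|star C v| = 3 -> tight C (V :\ v).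
Proof.
move=> vV d3; have := circuit_star_card v; rewrite d3.
have := circuit_card; have := cardsD1 v V; rewrite vV /tight => *; apply/eqP; lia.
Qed.

(** The degrees are at least 3 and sum to [4n - 4]. *)
Lemma circuit_many_degree3 : 4 <= #|[set v in V | #|star C v| == 3]|.
Proof.
set D := [set v in V | _].
have H : 4 * #|V| <= \sum_(v in V) #|star C v| + #|D|.
  have -> : #|D| = \sum_(v in V) (#|star C v| == 3).
    rewrite -sum1_card big_mkcond [RHS]big_mkcond /=; apply: eq_bigr => v _.
    by rewrite inE; case: (v \in V) => //=; case: (_ == 3).
  rewrite -big_split /= -sum1_card big_distrr /=; apply: leq_sum => v vV.
  have := circuit_min_degree vV; case: eqP => /=; lia.
move: H; rewrite sum_card_star; last exact: circuit_graph.
have := circuit_card; lia.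
Qed.

Lemma circuit_nonadjacent_degree3 : 5 <= #|V| ->
  exists a b, [/\ a \in V, b \in V, a != b & [set a; b] \notin C]
    /\ #|star C a| = 3 /\ #|star C b| = 3.
Proof.
move=> V5; set D := [set v in V | #|star C v| == 3].
have D4 : 4 <= #|D| := circuit_many_degree3.
case: (boolP ([set e : {set T} | (e \subset D) && (#|e| == 2)] \subset C)) => [sub|].
  exfalso.
  (* A clique on [D] has at least [3|D| - 6] edges: too many for a proper subset with 4 or more
     vertices, and for all of [V] with 5 or more. *)
  have le : 'C(#|D|, 2) <= #|span C D|.
    rewrite -card_pairs; apply/subset_leq_card/subsetP => e eP.
    by rewrite inE (subsetP sub) //; move: eP; rewrite inE => /andP[].
  have sDV : D \subset V by apply/subsetP => v; rewrite inE => /andP[].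
  move: le; case: (eqVproper sDV) => [-> | prop].
    rewrite span_vset; have := circuit_card; have := bin2_lower_bound #|V|; lia.
  have := circuit_sparse prop; have := bin2_lower_bound #|D|; lia.
case/subsetPn=> e; rewrite inE => /andP[eD /cards2P[a [b [ab E]]]] eC.
exists a, b; move: eD; rewrite E subUset !sub1set !inE -!andbA.
by case/and4P=> aV /eqP d3 bV /eqP d3'; rewrite E in eC.
Qed.

(** * Splitting a circuit into two smaller ones *)

(* Minimality of [X] makes every smaller set through [u, v] non-tight, which
   leaves room for the extra edge. *)
Lemma circuit_of_tight a u v : a \in V -> #|star C a| = 3 ->
  u \in V -> v \in V -> u != v -> u != a -> v != a -> [set u; v] \notin C ->
  exists X, [/\ X \subset V :\ a, tight C X, [set u; v] \subset X,
    is_circuit ([set u; v] |: span C X) & vset ([set u; v] |: span C X) = X].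
Proof.
move=> aV d3 uV vV uv ua va eC; set e := [set u; v].
pose P X := [&& X \subset V :\ a, tight C X & e \subset X].
have P0 : P (V :\ a).
  by rewrite /P subxx circuit_degree3 //= subUset !sub1set !inE uV vV ua va.
have [X /and3P[sX tX eX] minX] : exists2 X : {set T}, P X &
    forall Y : {set T}, P Y -> #|X| <= #|Y|.
  by case: (arg_minnP (fun X : {set T} => #|X|) P0) => X; exists X.
have e2 : #|e| = 2 by rewrite cards2 uv.
set G := e |: span C X.
have cG : #|G| + 2 = 2 * #|X|.
  have eS : e \notin span C X by rewrite inE (negbTE eC).
  by rewrite cardsU1 eS; move/eqP: tX; clear; card_lia.
have pX : X \proper V := sub_proper_trans sX (properD1 aV).
have sp Y : Y \proper X -> 2 <= #|Y| -> #|span G Y| + 3 <= 2 * #|Y|.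
  move=> pY Y2; have pYV := proper_trans pY pX; have := circuit_sparse pYV Y2.
  case: (boolP (e \subset Y)) => eY.
    have sG : span G Y \subset e |: span C Y.
      by apply/subsetP => f; rewrite !inE; case: (f == e) => //= /andP[/andP[-> _] ->].
    have := subset_leq_card sG; rewrite cardsU1.
    have nt : ~~ tight C Y.
      apply/negP => tY; have := minX Y; rewrite /P tY eY.
      rewrite (subset_trans (proper_sub pY) sX) => /(_ isT).
      by have := proper_card pY; clear; card_lia.
    move: nt; rewrite /tight; case: (e \notin _); clear; card_lia.
  have sG : span G Y \subset span C Y.
    apply/subsetP => f; rewrite !inE => /andP[/orP[/eqP->|/andP[-> _]] //].
    by rewrite (negbTE eY).
  have := subset_leq_card sG; clear; card_lia.
have VG : vset G = X.
  have sub : vset G \subset X.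
    apply/bigcupsP => f; rewrite !inE => /orP[/eqP-> // | /andP[_ //]].
  (* Were [vset G] smaller than [X], it would span all [2|X| - 2] edges, against [sp]. *)
  case: (eqVproper sub) => // pG.
  have eG : e \subset vset G by apply: sub_vset; rewrite !inE eqxx.
  have := sp _ pG; rewrite span_vset -{1}e2 subset_leq_card // => /(_ isT).
  by move: cG; have := proper_card pG; clear; card_lia.
exists X; split=> //; split; rewrite ?VG //.
move=> f; rewrite !inE => /orP[/eqP-> // | /andP[fC _]].
exact: circuit_graph.
Qed.

Lemma circuit_resultant : 5 <= #|V| -> exists C1 C2 e,
  [/\ is_circuit C1, is_circuit C2, #|vset C1| < #|V|, #|vset C2| < #|V|
    & is_CR C C1 C2 e].
Proof.
move=> V5; have [a [b [[aV bV ab nab] [da db]]]] := circuit_nonadjacent_degree3 V5.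
set W := V :\ a :\ b.
have gC := circuit_graph.
have cW : #|W| + 2 = #|V|.
  have := cardsD1 a V; have := cardsD1 b (V :\ a).
  by rewrite -/W !inE aV bV eq_sym ab; clear; card_lia.
have spW : sparse_within C W.
  move=> X sX; apply: circuit_sparse; apply: sub_proper_trans sX _.
  exact: sub_proper_trans (subsetDl _ _) (properD1 aV).
(* Non-adjacency keeps the degree of [b] at 3 after [a] is removed, so six edges are lost and
   [2|W| - 4] remain. *)
have nW : ~~ tight C W.
  have star_b : star (span C (V :\ a)) b = star C b.
    apply/setP => e; rewrite !inE; case eC: (e \in C) => //=.
    case be: (b \in e); rewrite ?andbF //= andbT subsetD1 sub_vset //=.
    apply: contraNN nab => ae; suff -> : [set a; b] = e by [].
    by apply/eqP; rewrite eqEcard subUset !sub1set ae be cards2 ab gC.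
  have := span_card_star C (V :\ a) b; rewrite star_b db.
  have := circuit_star_card a; rewrite da; have := circuit_card.
  move: cW; rewrite /tight -/W; clear; card_lia.
have W2 : 2 <= #|W| by move: cW V5; clear; card_lia.
have [u [v [uW vW uv nt]]] := exists_untight_pair gC spW W2 nW.
have euvW : [set u; v] \subset W by rewrite subUset !sub1set uW.
(* An edge is itself a tight set. *)
have eC : [set u; v] \notin C.
  apply/negP => eC; have := nt [set u; v] euvW.
  by rewrite !inE !eqxx orbT (tight_edge gC uv eC) => /(_ isT isT).
move: (uW) (vW); rewrite !inE => /and3P[ub ua uV] /and3P[vb va vV].
have [X [sX tX eX cX vX]] := circuit_of_tight aV da uV vV uv ua va eC.
have [Y [sY tY eY cY vY]] := circuit_of_tight bV db uV vV uv ub vb eC.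
have sXYW : X :&: Y \subset W.
  apply/subsetP => z /setIP[/(subsetP sX) zX /(subsetP sY)]; rewrite !inE => /andP[-> _].
  by move: zX; rewrite !inE.
have [uXY vXY] : u \in X :&: Y /\ v \in X :&: Y.
  by move: eX eY; rewrite !subUset !sub1set !inE => /andP[-> ->] /andP[-> ->].
have ntI := nt _ sXYW uXY vXY.
have I2 : 2 <= #|X :&: Y| by apply/card_gt1P; exists u, v.
have spI := spW _ sXYW I2.
have sUV : X :|: Y \subset V.
  by rewrite subUset (subset_trans sX) ?(subset_trans sY) ?subsetDl.
(* The intersection is not tight, so it spans at most [2|X :&: Y| - 4] edges; this is one edge more
   than a proper subset of [V] may span. *)
have big : 2 * #|X :|: Y| <= #|span C X :|: span C Y| + 2.
  have := cardsUI X Y; have := cardsUI (span C X) (span C Y); rewrite -spanI.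
  move: tX tY ntI spI; rewrite /tight; clear; card_lia.
have sUU : span C X :|: span C Y \subset span C (X :|: Y).
  by rewrite subUset !spanS ?subsetUl ?subsetUr.
have XYV : X :|: Y = V.
  case: (eqVproper sUV) => // prop; have := circuit_sparse prop.
  have := subset_leq_card sUU; have := subset_leq_card (subsetIl X Y).
  have := subset_leq_card (subsetUl X Y); move: big I2; clear; card_lia.
have UC : span C X :|: span C Y = C.
  by apply/eqP; rewrite eqEcard subUset !span_sub -(leq_add2r 2) circuit_card -XYV.
exists ([set u; v] |: span C X), ([set u; v] |: span C Y), [set u; v].
split=> //; rewrite ?vX ?vY.
- by have := subset_leq_card sX; have := cardsD1 a V; rewrite aV; clear; card_lia.
- by have := subset_leq_card sY; have := cardsD1 b V; rewrite bV; clear; card_lia.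
split; rewrite ?vX ?vY //.
(* Equal circuits would give [X = Y], making the intersection tight. *)
- apply/eqP => E; have XY : X = Y by rewrite -vX -vY E.
  by move: ntI; rewrite XY setIid tY.
- by rewrite !inE eqxx.
apply/setP => f; rewrite -{1}UC !inE; case: (f =P [set u; v]) => //= ->.
by rewrite (negbTE eC).
Qed.

End Circuit.

(** With [n] fixed and [l] free the level bound is an invariant: each child loses at least one
    vertex while its level rises by one. *)
Lemma resultant_tree n l C : is_circuit C -> #|vset C| + l <= n ->
  exists t : rtree T, rt_root t = C /\ res_tree n l t.
Proof.
have [k] := ubnP #|vset C|; elim: k C l => // k IH C l ltk circC le.
have := circuit_card_ge4 circC; rewrite leq_eqVlt => /orP[/eqP E | V5].
  exists (Leaf C); split=> //; split=> //; exact: circuit_K4.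
have [C1 [C2 [e [c1 c2 lt1 lt2 cr]]]] := circuit_resultant circC V5.
have [t1 [r1 h1]] : exists t, rt_root t = C1 /\ res_tree n l.+1 t.
  by apply: IH => //; move: ltk le lt1 lt2; clear; card_lia.
have [t2 [r2 h2]] : exists t, rt_root t = C2 /\ res_tree n l.+1 t.
  by apply: IH => //; move: ltk le lt1 lt2; clear; card_lia.
exists (Node C t1 t2); split=> //=; split=> //.
by exists e; rewrite r1 r2.
Qed.

End Circuits.

Theorem theorem1 (T : finType) (C : {set {set T}}) :
  is_circuit C ->
  exists t : rtree T, rt_root t = C /\ res_tree #|vset C| 0 t.
Proof.
by move=> circC; apply: resultant_tree => //; rewrite addn0.
Qed.
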